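(* Let $m\ge 1$ and let $\mathfrak{D}_m$ be the $(2m+2)$-dimensional real general Diamond Lie algebra with basis $\{J,P_1,\dots,P_m,Q_1,\dots,Q_m,T\}$. Then $\mathfrak{D}_m$ is isomorphic to a subalgebra of $\mathfrak{sp}(2m+2,\mathbb{R})$ via the linear map $$a J+\sum_{k=1}^mb_kP_k+\sum_{k=1}^mc_kQ_k+d T \ \mapsto\ \left(\begin{array}{ccccc|ccccc} 0&b_1&b_2&\dots&b_m&c_m&\dots&c_2&c_1&2d\\ 0&0&0&\dots&0&0&\dots&0&-a&c_1\\ 0&0&0&\dots&0&0&\dots&-a&0&c_2\\ \vdots&\vdots&\vdots&\ddots&\vdots&\vdots&\vdots&\vdots&\vdots&\vdots\\ 0&0&0&\dots&0&-a&\dots&0&0&c_m\\ \hline 0&0&0&\dots&a&0&\dots&0&0&-b_m\\ \vdots&\vdots&\vdots&\ddots&\vdots&\vdots&\ddots&\vdots&\vdots&\vdots\\ 0&0&a&\dots&0&0&\dots&0&0&-b_2\\ 0&a&0&\dots&0&0&\dots&0&0&-b_1\\ 0&0&0&\dots&0&0&\dots&0&0&0 \end{array}\right)$$ for $a,b_k,c_k,d\in\mathbb{R}$; that is, this map is an injective Lie algebra homomorphism into $\mathfrak{sp}(2m+2,\mathbb{R})$.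
   Context: $\mathfrak{D}_m$ is the real Lie algebra with basis $\{J,P_1,\dots,P_m,Q_1,\dots,Q_m,T\}$ whose nonzero brackets of basis elements are, up to antisymmetry, $$[J,P_k]=Q_k,\qquad [J,Q_k]=-P_k,\qquad [P_k,Q_k]=T,\qquad 1\le k\le m.$$ In terms of matrix units $e_{p,q}$ of size $2m+2$, the map of the claim sends $J\mapsto -\sum_{s=2}^{m+1}e_{s,2m+3-s}+\sum_{s=m+2}^{2m+1}e_{s,2m+3-s}$, $T\mapsto 2e_{1,2m+2}$, $P_k\mapsto e_{1,1+k}-e_{2m+2-k,2m+2}$, $Q_k\mapsto e_{1,2m+2-k}+e_{k+1,2m+2}$. $\mathfrak{sp}(2m+2,\mathbb{R})$ is the Lie algebra, under the commutator, of real $(2m+2)\times(2m+2)$ matrices $A$ with $A^{t}\Omega+\Omega A=0$, where $\Omega=\begin{pmatrix}0&K\\-K&0\end{pmatrix}$ and $K$ is the $(m+1)\times(m+1)$ matrix with $1$'s on the antidiagonal and $0$'s elsewhere. *)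

(* Defs.v *)
From HB Require Import structures.
From mathcomp Require Import all_boot all_order all_algebra.
From mathcomp Require Import ring.

Set Implicit Arguments.
Unset Strict Implicit.
Unset Printing Implicit Defensive.

Import GRing.Theory.
Local Open Scope ring_scope.

HB.mixin Record Lmodule_isLieAlgebra (R : comNzRingType) (L : Type)
    of GRing.Lmodule R L := {
  lie : L -> L -> L;
  lie_linearl : forall z : L, linear (lie^~ z);
  lie_linearr : forall z : L, linear (lie z);
  liexx : forall x : L, lie x x = 0;
  lie_jacobi : forall x y z : L,
    lie x (lie y z) + lie y (lie z x) + lie z (lie x y) = 0
}.

#[short(type="lieAlgType")]
HB.structure Definition LieAlgebra (R : comNzRingType) :=
  { L of GRing.Lmodule R L & Lmodule_isLieAlgebra R L }.

Definition lie_morphism (R : comNzRingType) (L1 L2 : lieAlgType R)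
    (f : L1 -> L2) : Prop :=
  linear f /\ forall x y : L1, f (lie x y) = lie (f x) (f y).

(* GenP k and GenQ k, with k : 'I_m counted from 0, stand for P_(k+1) and     *)
(* Q_(k+1).                                                                   *)
Inductive diamond_gen (m : nat) : Type :=
  GenJ | GenP of 'I_m | GenQ of 'I_m | GenT.
Arguments GenJ {m}.
Arguments GenT {m}.

Section DiamondGen.
Variable m : nat.

Definition gen_code (g : diamond_gen m) : (bool + ('I_m + 'I_m))%type :=
  match g with
  | GenJ => inl true
  | GenT => inl false
  | GenP k => inr (inl k)
  | GenQ k => inr (inr k)
  end.

Definition gen_decode (c : bool + ('I_m + 'I_m)) : diamond_gen m :=
  match c with
  | inl b => if b then GenJ else GenT
  | inr (inl k) => GenP k
  | inr (inr k) => GenQ k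
  end.

Lemma gen_codeK : cancel gen_code gen_decode.
Proof. by case. Qed.

Lemma gen_decodeK : cancel gen_decode gen_code.
Proof. by case=> [[]|[]]. Qed.

HB.instance Definition _ := Finite.copy (diamond_gen m) (can_type gen_codeK).

Lemma card_diamond_gen : #|{: diamond_gen m}| = (2 * m + 2)%N.
Proof.
rewrite (bij_eq_card (Bijective gen_codeK gen_decodeK)).
by rewrite !card_sum card_bool !card_ord addnC mul2n addnn.
Qed.

Lemma big_diamond_gen (V : nmodType) (F : diamond_gen m -> V) :
  \sum_g F g = F GenJ + \sum_k F (GenP k) + \sum_k F (GenQ k) + F GenT.
Proof.
rewrite (reindex gen_decode) /=; last first.
  exact: onW_bij (Bijective gen_decodeK gen_codeK).
rewrite big_sumType big_bool big_sumType /= -!addrA; congr (_ + _).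
by rewrite addrC -addrA.
Qed.

End DiamondGen.

(* The free module on the generators, the value of a vector at a generator    *)
(* being its coordinate there.                                                *)
Definition diamond (R : comNzRingType) (m : nat) : Type :=
  {ffun diamond_gen m -> R^o}.

Section Diamond.
Variables (R : comNzRingType) (m : nat).
Local Notation D := (diamond R m).

HB.instance Definition _ :=
  GRing.Lmodule.copy D {ffun diamond_gen m -> R^o}.

Definition diamond_basis (g : diamond_gen m) : D := [ffun h => (h == g)%:R].

Definition diamond_gen_lie (g h : diamond_gen m) : D :=
  match g, h with
  | GenJ, GenP k => diamond_basis (GenQ k)
  | GenP k, GenJ => - diamond_basis (GenQ k)
  | GenJ, GenQ k => - diamond_basis (GenP k)
  | GenQ k, GenJ => diamond_basis (GenP k)
  | GenP k, GenQ l => if k == l then diamond_basis GenT else 0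
  | GenQ l, GenP k => if k == l then - diamond_basis GenT else 0
  | _, _ => 0
  end.

Definition diamond_lie (u v : D) : D :=
  \sum_g \sum_h (u g * v h) *: diamond_gen_lie g h.

Lemma diamond_basis_sum (u : D) : u = \sum_g u g *: diamond_basis g.
Proof.
apply/ffunP => h; rewrite sum_ffunE (bigD1 h) //= !ffunE eqxx big1 ?addr0.
  by rewrite -[RHS]/(u h * 1) mulr1.
by move=> g; rewrite eq_sym !ffunE => /negPf ->; exact: mulr0.
Qed.

Lemma diamond_lie_basis (g h : diamond_gen m) :
  diamond_lie (diamond_basis g) (diamond_basis h) = diamond_gen_lie g h.
Proof.
rewrite /diamond_lie (bigD1 g) //= (bigD1 h) //= !ffunE !eqxx mulr1 scale1r.
rewrite !big1 ?addr0 // => [x /negPf xg|y /negPf yh].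
  by apply: big1 => y _; rewrite !ffunE xg mul0r scale0r.
by rewrite !ffunE yh mulr0 scale0r.
Qed.

Lemma diamond_lieE (u v : D) (g : diamond_gen m) :
  diamond_lie u v g =
  match g with
  | GenJ => 0
  | GenP k => u (GenQ k) * v GenJ - u GenJ * v (GenQ k)
  | GenQ k => u GenJ * v (GenP k) - u (GenP k) * v GenJ
  | GenT => \sum_k (u (GenP k) * v (GenQ k) - u (GenQ k) * v (GenP k))
  end.
Proof.
pose d (g h : diamond_gen m) : R := (g == h)%:R.
have dP k l : d (GenP k) (GenP l) = (k == l)%:R by [].
have dQ k l : d (GenQ k) (GenQ l) = (k == l)%:R by [].
have delta (F : 'I_m -> R) k : \sum_i F i * (k == i)%:R = F k.
  rewrite (bigD1 k) //= eqxx mulr1 big1 ?addr0 // => i.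
  by rewrite eq_sym => /negPf ->; rewrite mulr0.
have diag (F : 'I_m -> 'I_m -> R) (c : R) k :
    \sum_l F k l * (if k == l then c else 0) = F k k * c.
  rewrite (bigD1 k) //= eqxx big1 ?addr0 // => i.
  by rewrite eq_sym => /negPf ->; rewrite mulr0.
pose G (x y : diamond_gen m) : R :=
  match x, y with
  | GenJ, GenP k => d g (GenQ k)
  | GenP k, GenJ => - d g (GenQ k)
  | GenJ, GenQ k => - d g (GenP k)
  | GenQ k, GenJ => d g (GenP k)
  | GenP k, GenQ l => if k == l then d g GenT else 0
  | GenQ l, GenP k => if l == k then - d g GenT else 0
  | _, _ => 0
  end.
have GE x y : diamond_gen_lie x y g = G x y.
  case: x y => [|k|k|] [|l|l|] /=; rewrite ?ffunE //.
    by case: eqP => _; rewrite ffunE.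
  by rewrite [l == k]eq_sym; case: eqP => _; rewrite !ffunE.
have -> : diamond_lie u v g = \sum_x \sum_y u x * v y * G x y.
  rewrite sum_ffunE; apply: eq_bigr => x _; rewrite sum_ffunE.
  by apply: eq_bigr => y _; rewrite ffunE GE.
have z (F : 'I_m -> R) : \sum_i F i * 0 = 0.
  by rewrite big1 // => i _; rewrite mulr0.
have RJ : \sum_y u GenJ * v y * G GenJ y =
    u GenJ * (\sum_k v (GenP k) * d g (GenQ k)
              - \sum_k v (GenQ k) * d g (GenP k)).
  rewrite big_diamond_gen /= !mulr0 add0r addr0 mulrBr !mulr_sumr -sumrN.
  by congr (_ + _); apply: eq_bigr => k _; rewrite ?mulrN mulrA.
have RP k : \sum_y u (GenP k) * v y * G (GenP k) y =
    - (u (GenP k) * v GenJ * d g (GenQ k))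
    + u (GenP k) * v (GenQ k) * d g GenT.
  rewrite big_diamond_gen /= (diag (fun k l => u (GenP k) * v (GenQ l))).
  by rewrite z mulr0 !addr0 mulrN.
have RQ k : \sum_y u (GenQ k) * v y * G (GenQ k) y =
    u (GenQ k) * v GenJ * d g (GenP k)
    - u (GenQ k) * v (GenP k) * d g GenT.
  rewrite big_diamond_gen /= (diag (fun k l => u (GenQ k) * v (GenP l))).
  by rewrite z mulr0 !addr0 mulrN.
have RT : \sum_y u GenT * v y * G GenT y = 0.
  by rewrite big1 // => y; rewrite mulr0.
rewrite big_diamond_gen RJ RT (eq_bigr _ (fun k _ => RP k)).
rewrite (eq_bigr _ (fun k _ => RQ k)) {RJ RT RP RQ} addr0 !big_split /= !sumrN.
case: g @d dP dQ @G GE => [|k|k|] d dP dQ G GE.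
- by rewrite /d /= !z subrr mulr0 !oppr0 !addr0.
- have vQ : \sum_l v (GenQ l) * d (GenP k) (GenP l) = v (GenQ k).
    exact: (delta (fun l => v (GenQ l)) k).
  have uQ : \sum_l u (GenQ l) * v GenJ * d (GenP k) (GenP l)
      = u (GenQ k) * v GenJ by exact: (delta (fun l => u (GenQ l) * v GenJ) k).
  by rewrite vQ uQ /d /= !z; ring.
- have vP : \sum_l v (GenP l) * d (GenQ k) (GenQ l) = v (GenP k).
    exact: (delta (fun l => v (GenP l)) k).
  have uP : \sum_l u (GenP l) * v GenJ * d (GenQ k) (GenQ l)
      = u (GenP k) * v GenJ by exact: (delta (fun l => u (GenP l) * v GenJ) k).
  by rewrite vP uP /d /= !z; ring.
- by rewrite /d /= !z -!mulr_suml; ring.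
Qed.

Fact diamond_lie_linearl (z : D) : linear (diamond_lie^~ z).
Proof.
move=> a x y; apply/ffunP=> g; rewrite !ffunE !diamond_lieE.
case: g => [|k|k|]; rewrite ?ffunE /GRing.scale /=; try ring.
rewrite mulr_sumr -big_split /=; apply: eq_bigr => k _.
by rewrite !ffunE /GRing.scale /=; ring.
Qed.

Fact diamond_lie_linearr (z : D) : linear (diamond_lie z).
Proof.
move=> a x y; apply/ffunP=> g; rewrite !ffunE !diamond_lieE.
case: g => [|k|k|]; rewrite ?ffunE /GRing.scale /=; try ring.
rewrite mulr_sumr -big_split /=; apply: eq_bigr => k _.
by rewrite !ffunE /GRing.scale /=; ring.
Qed.

Fact diamond_liexx (x : D) : diamond_lie x x = 0.
Proof.
apply/ffunP=> g; rewrite ffunE diamond_lieE.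
case: g => [|k|k|]; try ring.
by apply: big1 => k _; ring.
Qed.

Fact diamond_lie_jacobi (x y z : D) :
  diamond_lie x (diamond_lie y z) + diamond_lie y (diamond_lie z x)
    + diamond_lie z (diamond_lie x y) = 0.
Proof.
apply/ffunP=> g; rewrite !ffunE !(diamond_lieE _ _ g).
case: g => [|k|k|]; rewrite ?diamond_lieE; try ring.
by rewrite -!big_split; apply: big1 => k _ /=; rewrite !diamond_lieE; ring.
Qed.

HB.instance Definition _ := Lmodule_isLieAlgebra.Build R D
  diamond_lie_linearl diamond_lie_linearr diamond_liexx diamond_lie_jacobi.

End Diamond.

Section Symplectic.
Variables (R : comNzRingType) (n : nat).

(* spalg R n is the algebra sp(2n, R), of matrices of size 2n.                *)
Definition antidiag_mx : 'M[R]_n := \matrix_(i, j) (j == rev_ord i)%:R.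

Definition sp_form : 'M[R]_(n + n) :=
  block_mx 0 antidiag_mx (- antidiag_mx) 0.

Definition spmx : {pred 'M[R]_(n + n)} :=
  fun A => A^T *m sp_form + sp_form *m A == 0.

Definition commx (A B : 'M[R]_(n + n)) : 'M[R]_(n + n) := A *m B - B *m A.

Fact spmx_submod_closed : submod_closed spmx.
Proof.
split=> [|a A B /eqP hA /eqP hB].
  by rewrite unfold_in trmx0 mul0mx mulmx0 addr0.
rewrite unfold_in linearP /= mulmxDl mulmxDr -scalemxAl -scalemxAr.
by rewrite addrACA -scalerDr hA hB scaler0 addr0.
Qed.

HB.instance Definition _ :=
  GRing.isSubmodClosed.Build R 'M[R]_(n + n) spmx spmx_submod_closed.

Lemma spmx_commx (A B : 'M[R]_(n + n)) :
  A \in spmx -> B \in spmx -> commx A B \in spmx.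
Proof.
move=> /eqP/addr0_eq hA /eqP/addr0_eq hB; apply/eqP.
rewrite /commx linearB /= !trmx_mul mulmxBl mulmxBr.
have eA : A^T *m sp_form = - (sp_form *m A) by rewrite -hA opprK.
have eB : B^T *m sp_form = - (sp_form *m B) by rewrite -hB opprK.
rewrite -!(mulmxA _ _ sp_form) eA eB !mulmxN !mulmxA eA eB.
by rewrite !mulNmx !opprK -!mulmxA addrC subrKA subrr.
Qed.

Record spalg : Type := SpAlg { spval : 'M[R]_(n + n); _ : spval \in spmx }.

HB.instance Definition _ := [isSub for spval].
HB.instance Definition _ := [Choice of spalg by <:].
HB.instance Definition _ := [SubChoice_isSubLmodule of spalg by <:].

Definition sp_lie (A B : spalg) : spalg :=
  SpAlg (spmx_commx (valP A) (valP B)).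

Fact sp_lie_linearl (Z : spalg) : linear (sp_lie^~ Z).
Proof.
move=> a X Y; apply: val_inj; rewrite linearP /= /commx linearP /=.
by rewrite mulmxDl -scalemxAl scalerBr opprD addrACA.
Qed.

Fact sp_lie_linearr (Z : spalg) : linear (sp_lie Z).
Proof.
move=> a X Y; apply: val_inj; rewrite linearP /= /commx linearP /=.
by rewrite mulmxDl -scalemxAl scalerBr opprD addrACA.
Qed.

Fact sp_liexx (X : spalg) : sp_lie X X = 0.
Proof. by apply: val_inj; rewrite /= /commx subrr. Qed.

Fact sp_lie_jacobi (X Y Z : spalg) :
  sp_lie X (sp_lie Y Z) + sp_lie Y (sp_lie Z X) + sp_lie Z (sp_lie X Y) = 0.
Proof.
apply: val_inj; rewrite !raddfD /= /commx.
case: X Y Z => [X _] [Y _] [Z _] /=.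
rewrite !mulmxBr !mulmxBl !mulmxA.
move: (X *m Y *m Z) (X *m Z *m Y) (Y *m Z *m X) (Y *m X *m Z)
  (Z *m X *m Y) (Z *m Y *m X) => A1 A2 A3 A4 A5 A6.
by apply/matrixP => i j; rewrite !mxE; ring.
Qed.

HB.instance Definition _ := Lmodule_isLieAlgebra.Build R spalg
  sp_lie_linearl sp_lie_linearr sp_liexx sp_lie_jacobi.

End Symplectic.

(* With N = 2m+2, rows and columns numbered from 1 and k ranging over 1..m,   *)
(* diamond_mx a b c d is                                                      *)
(*   a * (\sum_k (e_(N-k, k+1) - e_(k+1, N-k)))                               *)
(*   + \sum_k b_k * (e_(1, k+1) - e_(N-k, N))                                 *)
(*   + \sum_k c_k * (e_(1, N-k) + e_(k+1, N)) + 2 * d * e_(1, N).             *)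
(* In the blocks below, indexed from 0, unlift ord0 splits off the first row  *)
(* or column and unlift ord_max the last one, leaving an index in 'I_m for    *)
(* the others.                                                                *)
Definition diamond_mx (R : comNzRingType) (m : nat)
    (a : R) (b c : 'I_m -> R) (d : R) : 'M[R]_(m.+1 + m.+1) :=
  block_mx
    (\matrix_(i, j)
       match unlift ord0 i, unlift ord0 j with
       | None, Some k => b k
       | _, _ => 0
       end)
    (\matrix_(i, j)
       match unlift ord0 i, unlift ord_max j with
       | None, Some k => c (rev_ord k)
       | None, None => 2 * d
       | Some k, Some l => if l == rev_ord k then - a else 0
       | Some k, None => c k
       end)
    (\matrix_(i, j)
       match unlift ord_max i, unlift ord0 j with
       | Some k, Some l => if l == rev_ord k then a else 0
       | _, _ => 0
       end)
    (\matrix_(i, j)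
       match unlift ord_max i, unlift ord_max j with
       | Some k, None => - b (rev_ord k)
       | _, _ => 0
       end).

(* Main.v *)
Require Import Defs.
From mathcomp Require Import all_boot all_order all_algebra reals.
From mathcomp Require Import ring.
Import GRing.Theory.
Local Open Scope ring_scope.

(** Write a matrix of the representation in its four blocks
      M = ul(b)  ur(a, c, d)
          ll(a)  lr(b)
    and index a row or column of the upper or left half by ord0 followed by
    the lift ord0 k, one of the lower or right half by the lift ord_max k
    followed by ord_max.  These are the same splittings in which the entries
    are given, so every block product is a sum in which at most one Kronecker
    delta, that of the antidiagonal J-part (the entries a and -a), has to be
    contracted.

    - Among the eight products of blocks four vanish.  The other four give the
      commutator (commx_diamond_mx): it again has the shape of M, its a being
      0 because the J-parts commute, and its b, c, d being the coordinates of
      the bracket of the diamond algebra.  The factor 2 in front of d is the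
      sum of the two equal contributions that the P-Q pairs make to the corner
      entry, one through the left half and one through the right half.
    - With K the antidiagonal matrix, multiplying by K reverses the rows or
      columns, and this reversal exchanges the two splittings of the indices.
      The condition of being symplectic says that K * ll and K * ur are
      symmetric and that K * lr = - (K * ul)^T, which can be read off the
      entries (diamond_mx_sp).
    - All parameters occur among the entries, d with the factor 2, so the map
      is injective as soon as 2 is regular and the J-part has positive size
      (diamond_mx_inj). *)

(** * Reversal of indices *)

Section Ordinals.
Context {m : nat}.

(** The reversal carries the splitting at [ord0] to the splitting at [ord_max],
    because it exchanges these two indices. *)
Lemma unlift_max_rev (i : 'I_m.+1) :
  unlift ord_max (rev_ord i) = omap (@rev_ord m) (unlift ord0 i).
Proof.
case: (unliftP ord0 i) => [k|] ->.
  suff -> : rev_ord (lift ord0 k) = lift ord_max (rev_ord k) by rewrite liftK.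
  by apply: val_inj; rewrite /= /bump leq0n add1n subSS leqNgt ltn_subrL
    (leq_ltn_trans _ (ltn_ord k)).
suff -> : rev_ord (ord0 : 'I_m.+1) = ord_max by rewrite unlift_none.
by apply: val_inj; rewrite /= subn1.
Qed.

Lemma unlift0_rev (i : 'I_m.+1) :
  unlift ord0 (rev_ord i) = omap (@rev_ord m) (unlift ord_max i).
Proof.
rewrite -{2}[i]rev_ordK unlift_max_rev.
by case: unlift => //= k; rewrite rev_ordK.
Qed.

Lemma eq_rev_ord (k l : 'I_m) : (k == rev_ord l) = (l == rev_ord k).
Proof. by rewrite -(inj_eq rev_ord_inj) rev_ordK eq_sym. Qed.

End Ordinals.

(** * The blocks and their products *)

Section Blocks.
Context {R : comNzRingType} {m : nat}.
Implicit Types (a d x : R) (b c : 'I_m -> R) (k l : 'I_m).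

Definition ul_mx b : 'M[R]_m.+1 :=
  \matrix_(i, j)
    match unlift ord0 i, unlift ord0 j with None, Some k => b k | _, _ => 0 end.

Definition ur_mx a c d : 'M[R]_m.+1 :=
  \matrix_(i, j)
    match unlift ord0 i, unlift ord_max j with
    | None, Some k => c (rev_ord k)
    | None, None => 2 * d
    | Some k, Some l => if l == rev_ord k then - a else 0
    | Some k, None => c k
    end.

Definition ll_mx a : 'M[R]_m.+1 :=
  \matrix_(i, j)
    match unlift ord_max i, unlift ord0 j with
    | Some k, Some l => if l == rev_ord k then a else 0
    | _, _ => 0
    end.

Definition lr_mx b : 'M[R]_m.+1 :=
  \matrix_(i, j)
    match unlift ord_max i, unlift ord_max j with
    | Some k, None => - b (rev_ord k)
    | _, _ => 0
    end.

Lemma diamond_mxE a b c d :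
  diamond_mx a b c d = block_mx (ul_mx b) (ur_mx a c d) (ll_mx a) (lr_mx b).
Proof. by []. Qed.

Lemma mulmx_unlift (h : 'I_m.+1) (A B : 'M[R]_m.+1) i j :
  (A *m B) i j = A i h * B h j + \sum_k A i (lift h k) * B (lift h k) j.
Proof. by rewrite mxE (bigD1_ord h). Qed.

Lemma sum_mul_if_eq (F : 'I_m -> R) l x :
  \sum_k F k * (if k == l then x else 0) = F l * x.
Proof.
rewrite (bigD1 l) //= eqxx big1 ?addr0 // => i /negPf ->; exact: mulr0.
Qed.

Lemma sum_mul_if_rev (F : 'I_m -> R) l x :
  \sum_k F k * (if l == rev_ord k then x else 0) = F (rev_ord l) * x.
Proof. by under eq_bigr do rewrite eq_rev_ord; exact: sum_mul_if_eq. Qed.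

Lemma sum_if_eq_mul (F : 'I_m -> R) l x :
  \sum_k (if k == l then x else 0) * F k = x * F l.
Proof. by under eq_bigr do rewrite mulrC; rewrite sum_mul_if_eq mulrC. Qed.

(** Each entry of a block product is split at [h], the index that the shared
    half treats specially; after the row and column cases only a contraction
    with a Kronecker delta remains. *)
Ltac block_product h i j :=
  apply/matrixP=> i j; rewrite (mulmx_unlift h) !mxE !unlift_none;
  under eq_bigr do rewrite !mxE liftK;
  case: (unlift _ i) => [?|]; case: (unlift _ j) => [?|];
  rewrite ?mulr0 ?mul0r ?add0r
    ?(sum_mul_if_rev, sum_mul_if_eq, sum_if_eq_mul) ?rev_ordK ?mulr0 ?mul0r //;
  try by rewrite big1 // => *; rewrite ?mulr0 ?mul0r.

Lemma mul_ul_ul b b' : ul_mx b *m ul_mx b' = 0.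
Proof. block_product (ord0 : 'I_m.+1) i j. Qed.

Lemma mul_lr_lr b b' : lr_mx b *m lr_mx b' = 0.
Proof. block_product (ord_max : 'I_m.+1) i j. Qed.

Lemma mul_ll_ul a b : ll_mx a *m ul_mx b = 0.
Proof. block_product (ord0 : 'I_m.+1) i j. Qed.

Lemma mul_lr_ll b a : lr_mx b *m ll_mx a = 0.
Proof. block_product (ord_max : 'I_m.+1) i j. Qed.

Lemma mul_ur_ll a c d a' :
  ur_mx a c d *m ll_mx a' =
  \matrix_(i, j) match unlift ord0 i, unlift ord0 j with
    | None, Some k => c k * a'
    | Some k, Some l => if l == k then - (a * a') else 0
    | _, _ => 0
    end.
Proof.
block_product (ord_max : 'I_m.+1) i j.
by rewrite (inj_eq rev_ord_inj); case: eqP; rewrite ?mulNr ?mul0r.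
Qed.

Lemma mul_ll_ur a a' c d :
  ll_mx a *m ur_mx a' c d =
  \matrix_(i, j) match unlift ord_max i, unlift ord_max j with
    | Some k, None => a * c (rev_ord k)
    | Some k, Some l => if l == k then - (a * a') else 0
    | _, _ => 0
    end.
Proof.
block_product (ord0 : 'I_m.+1) i j.
by rewrite (inj_eq rev_ord_inj); case: eqP; rewrite ?mul0r ?mulrN.
Qed.

Lemma mul_ul_ur b a c d :
  ul_mx b *m ur_mx a c d =
  \matrix_(i, j) match unlift ord0 i, unlift ord_max j with
    | None, Some k => - (b (rev_ord k) * a)
    | None, None => \sum_k b k * c k
    | _, _ => 0
    end.
Proof.
block_product (ord0 : 'I_m.+1) i j.
by rewrite mulrN.
Qed.

Lemma mul_ur_lr a c d b :
  ur_mx a c d *m lr_mx b =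
  \matrix_(i, j) match unlift ord0 i, unlift ord_max j with
    | Some k, None => a * b k
    | None, None => - \sum_k c k * b k
    | _, _ => 0
    end.
Proof.
block_product (ord_max : 'I_m.+1) i j.
  by rewrite mulrNN.
(* Row 0 of the upper right block lists c in reverse order. *)
rewrite [in RHS](reindex_inj rev_ord_inj) -sumrN /=.
by apply: eq_bigr => k _; rewrite mulrN.
Qed.

(** * The commutator *)

(** The diagonal deltas, with coefficients [- (a * a')] and [- (a' * a)], cancel
    in the commutator; what is left are the rotations of the P-Q planes by the
    J-part and, in the corner, twice the symplectic pairing of [(b, c)] with
    [(b', c')]. *)
Lemma commx_diamond_mx a b c d a' b' c' d' :
  commx (diamond_mx a b c d) (diamond_mx a' b' c' d') =
  diamond_mx 0 (fun k => c k * a' - a * c' k) (fun k => a * b' k - b k * a')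
    (\sum_k (b k * c' k - c k * b' k)).
Proof.
rewrite /commx !diamond_mxE !mulmx_block.
rewrite !(mul_ul_ul, mul_lr_lr, mul_ll_ul, mul_lr_ll).
rewrite !(mul_ur_ll, mul_ll_ur, mul_ul_ur, mul_ur_lr).
rewrite opp_block_mx add_block_mx.
congr block_mx; apply/matrixP=> i j; rewrite !mxE;
  case: (unlift _ i) => [k|]; try case: (unlift _ j) => [l|];
  try case: eqP => _; try ring.
(* The corner entry collects four sums, equal in pairs. *)
have -> : \sum_k c' k * b k = \sum_k b k * c' k.
  by apply: eq_bigr => k _; rewrite mulrC.
have -> : \sum_k b' k * c k = \sum_k c k * b' k.
  by apply: eq_bigr => k _; rewrite mulrC.
rewrite sumrB; ring.
Qed.

(** * The symplectic condition *)

Lemma mul_antidiagl (A : 'M[R]_m.+1) :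
  antidiag_mx R m.+1 *m A = \matrix_(i, j) A (rev_ord i) j.
Proof.
apply/matrixP=> i j; rewrite !mxE (bigD1 (rev_ord i)) //= mxE eqxx mul1r.
by rewrite big1 ?addr0 // => k /negPf ik; rewrite mxE ik mul0r.
Qed.

Lemma mul_antidiagr (A : 'M[R]_m.+1) :
  A *m antidiag_mx R m.+1 = \matrix_(i, j) A i (rev_ord j).
Proof.
apply/matrixP=> i j; rewrite !mxE (bigD1 (rev_ord j)) //= mxE rev_ordK eqxx.
by rewrite mulr1 big1 ?addr0 // => k /negPf ik; rewrite mxE eq_rev_ord ik mulr0.
Qed.

Lemma diamond_mx_sp a b c d : diamond_mx a b c d \in @spmx R m.+1.
Proof.
apply/eqP; rewrite diamond_mxE /sp_form tr_block_mx !mulmx_block.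
rewrite !mulmx0 !mul0mx !addr0 !add0r !mulmxN !mulNmx.
rewrite !mul_antidiagl !mul_antidiagr add_block_mx -[RHS]block_mx0.
congr block_mx; apply/matrixP=> i j; rewrite !mxE.
all: rewrite !(unlift0_rev, unlift_max_rev).
all: case: (unlift _ i) => [k|]; case: (unlift _ j) => [l|].
all: rewrite /= ?rev_ordK.
(* Reflection in the antidiagonal preserves the deltas of ll and ur. *)
all: try (rewrite [l == k]eq_sym; case: eqP => _).
all: try ring.
Qed.

(** * The representation *)

Lemma diamond_mx_linear x a b c d a' b' c' d' :
  diamond_mx (x * a + a') (fun k => x * b k + b' k) (fun k => x * c k + c' k)
    (x * d + d')
  = x *: diamond_mx a b c d + diamond_mx a' b' c' d'.
Proof.
rewrite !diamond_mxE scale_block_mx add_block_mx.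
congr block_mx; apply/matrixP=> i j; rewrite !mxE;
  case: (unlift _ i) => [k|]; try case: (unlift _ j) => [l|];
  try case: eqP => _; ring.
Qed.

Lemma eq_diamond_mx a b b' c c' d :
  b =1 b' -> c =1 c' -> diamond_mx a b c d = diamond_mx a b' c' d.
Proof.
move=> bb' cc'; rewrite !diamond_mxE.
congr block_mx; apply/matrixP=> i j; rewrite !mxE;
  case: (unlift _ i) => [k|]; try case: (unlift _ j) => [l|];
  by rewrite ?bb' ?cc'.
Qed.

(** Only the antidiagonal of the J-part shows [a], hence the need for [0 < m]:
    for [m = 0] that part is empty. *)
Lemma diamond_mx_inj a b c d a' b' c' d' :
  (0 < m)%N -> GRing.lreg (2 : R) ->
  diamond_mx a b c d = diamond_mx a' b' c' d' ->
  [/\ a = a', b =1 b', c =1 c' & d = d'].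
Proof.
move=> m_gt0 reg2; rewrite !diamond_mxE.
case/eq_block_mx => /matrixP ul /matrixP ur /matrixP ll _.
split=> [|k|k|].
- pose k := Ordinal m_gt0.
  have := ll (lift ord_max k) (lift ord0 (rev_ord k)).
  by rewrite !mxE !liftK eqxx.
- by have := ul ord0 (lift ord0 k); rewrite !mxE !liftK unlift_none.
- have := ur ord0 (lift ord_max (rev_ord k)).
  by rewrite !mxE !liftK unlift_none rev_ordK.
- by have := ur ord0 ord_max; rewrite !mxE !unlift_none => /reg2.
Qed.

Definition diamond_rep (u : diamond R m) : spalg R m.+1 :=
  SpAlg (diamond_mx_sp (u GenJ) (u \o @GenP m) (u \o @GenQ m) (u GenT)).

Lemma diamond_rep_morphism : lie_morphism diamond_rep.
Proof.
split=> [x u v|u v]; apply: val_inj.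
  rewrite linearP /= -diamond_mx_linear !ffunE.
  by apply: eq_diamond_mx => k; rewrite /= !ffunE.
rewrite [RHS]commx_diamond_mx /= !diamond_lieE.
by apply: eq_diamond_mx => k; rewrite /= diamond_lieE.
Qed.

Lemma diamond_rep_inj :
  (0 < m)%N -> GRing.lreg (2 : R) -> injective diamond_rep.
Proof.
move=> m_gt0 reg2 u v /(congr1 val) /= uv.
have [uvJ uvP uvQ uvT] := diamond_mx_inj _ _ _ _ _ _ _ _ m_gt0 reg2 uv.
by apply/ffunP => -[|k|k|]; [|exact: uvP|exact: uvQ|].
Qed.

Lemma diamond_repE a b c d :
  spval (diamond_rep (a *: diamond_basis R GenJ
                      + \sum_k b k *: diamond_basis R (GenP k)
                      + \sum_k c k *: diamond_basis R (GenQ k)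
                      + d *: diamond_basis R GenT))
  = diamond_mx a b c d.
Proof.
pose w : diamond R m := [ffun g => match g with
  GenJ => a | GenP k => b k | GenQ k => c k | GenT => d end].
have -> : a *: diamond_basis R GenJ + \sum_k b k *: diamond_basis R (GenP k)
    + \sum_k c k *: diamond_basis R (GenQ k) + d *: diamond_basis R GenT = w.
  rewrite [RHS]diamond_basis_sum big_diamond_gen !ffunE.
  by congr (_ + _ + _ + _); apply: eq_bigr => k _; rewrite ffunE.
by rewrite /= !ffunE; apply: eq_diamond_mx => k; rewrite /= ffunE.
Qed.

End Blocks.

Theorem proposition2 (R : realType) (m : nat) (hm : (0 < m)%N) :
  exists f : diamond R m -> spalg R m.+1,
    [/\ lie_morphism f,
        injective f
      & forall (a : R) (b c : 'I_m -> R) (d : R),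
          spval (f (a *: diamond_basis R GenJ
                    + \sum_(k < m) b k *: diamond_basis R (GenP k)
                    + \sum_(k < m) c k *: diamond_basis R (GenQ k)
                    + d *: diamond_basis R GenT))
          = diamond_mx a b c d].
Proof.
exists diamond_rep; split; first exact: diamond_rep_morphism.
  by apply: diamond_rep_inj => //; apply/lregP; rewrite Num.Theory.pnatr_eq0.
exact: diamond_repE.
Qed.
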